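(* Let $\Omega^L$ be the deficient digit set and for $x\in\Omega^L$ let $L_x^{loc}$ be the local level set of $x$. Let $\Lambda_H^L$ denote the set of $x\in\Omega^L$ such that the Hausdorff dimension of $L_x^{loc}$ is positive, i.e. $$\Lambda_H^L:=\{x\in\Omega^L:\ \dim_H(L_x^{loc})>0\}.$$ This set has full Hausdorff dimension, i.e. $\dim_H(\Lambda_H^L)=1$. In particular, the deficient digit set $\Omega^L$ has Hausdorff dimension $1$.
   Context: $\dim_H$ denotes Hausdorff dimension of subsets of $\mathbb{R}$. Throughout, $x\in[0,1]$ denotes a binary expansion $x=\sum_{j\ge1}b_j2^{-j}=0.b_1b_2b_3\ldots$ with $b_j\in\{0,1\}$ (a dyadic rational with two such expansions is treated as two separate expansions). For $j\ge1$ put $D_j(x)=j-2(b_1+\cdots+b_j)$, the number of $0$'s minus the number of $1$'s among the first $j$ digits. Deficient digit set: $\Omega^L=\{x=\sum_{j\ge1}b_j2^{-j}:\ D_j(x)\ge0\text{ for all }j\ge1\}\subset[0,1]$. Local level sets: let $c_0(x)=0$ and let $c_1(x)<c_2(x)<\cdots$ be the (finitely or infinitely many) indices $j\ge1$ with $D_j(x)=0$; the balance-set is $Z(x)=\{c_k(x)\}$. If it is finite with last element $c_n(x)$, set $c_{n+1}(x)=+\infty$. The blocks of $x$ are the indexed sets of digits $B_k(x)=\{b_j:\ c_k(x)<j\le c_{k+1}(x)\}$ (with $j<\infty$). For two binary expansions $x,x'$ write $x\sim x'$ if $Z(x)=Z(x')$ and, for every $k\ge0$, either $B_k(x)=B_k(x')$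 or $B_k(x')$ is obtained from $B_k(x)$ by flipping every digit $b_j\mapsto1-b_j$ in the block. The local level set of $x$ is $L_x^{loc}=\{x':\ x'\sim x\}$, regarded as a subset of $[0,1]$ when computing its Hausdorff dimension. *)

(* Defs.v *)
From HB Require Import structures.
From mathcomp Require Import all_boot all_order all_algebra.
From mathcomp Require Import all_classical all_reals all_analysis.

Set Implicit Arguments.
Unset Strict Implicit.
Unset Printing Implicit Defensive.

Import Order.TTheory GRing.Theory Num.Theory.
Import numFieldNormedType.Exports.

Local Open Scope classical_set_scope.
Local Open Scope ring_scope.

Section Hausdorff.
Context {R : realType}.
Local Open Scope ereal_scope.

(* The added 0 only matters for the empty set, which gets diameter 0. *)
Definition diam (A : set R) : \bar R :=
  ereal_sup (0 |` [set (`|z.1 - z.2|)%:E | z in A `*` A]).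

(* The empty set is given weight 0 even when s = 0, where 0 `^ 0 = 1; this
   lets sequences of possibly empty sets stand for at most countable covers
   and makes the 0-dimensional Hausdorff measure the counting measure. *)
Definition diam_weight (s : R) (A : set R) : \bar R :=
  if A == set0 then 0 else diam A `^ s.

Definition hausdorff_premeasure (s delta : R) (A : set R) : \bar R :=
  ereal_inf [set \sum_(0 <= i <oo) diam_weight s (U i) | U in
    [set U : (set R)^nat | A `<=` \bigcup_i U i /\
                           forall i, diam (U i) <= delta%:E]].

Definition hausdorff_measure (s : R) (A : set R) : \bar R :=
  ereal_sup [set hausdorff_premeasure s delta A | delta in
    [set delta : R | (0 < delta)%R]].

Definition hausdorff_dim (A : set R) : \bar R :=
  ereal_inf [set s%:E | s in
    [set s : R | (0 <= s)%R /\ hausdorff_measure s A = 0]].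

End Hausdorff.

(* Digits are numbered from 0: [b i] is the digit of weight 2^-(i+1), so the
   first [j] digits are [b 0, ..., b (j-1)]. The two expansions of a dyadic
   rational are distinct objects. *)
Definition expansion := nat -> bool.

Definition expansion_val (R : realType) (b : expansion) : R :=
  limn (series (fun i => (b i)%:R / 2 ^+ i.+1 : R)).

Definition deficiency (b : expansion) (j : nat) : int :=
  j%:Z - 2 * (\sum_(i < j) b i)%N%:Z.

Definition deficient_digit_set : set expansion :=
  [set b | forall j, (1 <= j)%N -> 0 <= deficiency b j].

(* The least balance index strictly above [c], or [None] if there is none. *)
Definition next_balance (b : expansion) (c : nat) : option nat :=
  match pselect (exists j, (c < j)%N && (deficiency b j == 0)) with
  | left ex => Some (ex_minn ex)
  | right _ => None
  end.

(* [balance b k] is c_k, with [None] when c_k is infinite or undefined. *)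
Fixpoint balance (b : expansion) (k : nat) : option nat :=
  if k is k'.+1 then obind (next_balance b) (balance b k') else Some 0%N.

Definition balance_set (b : expansion) : set nat :=
  [set c | exists k, balance b k = Some c].

(* An indexed set of digits is a set of pairs (position, digit). With digits
   numbered from 0, c_k < j <= c_(k+1) becomes c_k <= i < c_(k+1). The block
   is empty when c_k is [None]. *)
Definition block (b : expansion) (k : nat) : set (nat * bool) :=
  [set (i, b i) | i in
    [set i | (exists2 c, balance b k = Some c & (c <= i)%N) /\
             (forall c, balance b k.+1 = Some c -> (i < c)%N)]].

Definition flip_block (B : set (nat * bool)) : set (nat * bool) :=
  [set (p.1, ~~ p.2) | p in B].

Definition local_equiv (b b' : expansion) : Prop :=
  balance_set b = balance_set b' /\
  forall k, block b k = block b' k \/ block b' k = flip_block (block b k).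

Definition local_level_set (b : expansion) : set expansion :=
  [set b' | local_equiv b' b].

Definition LambdaHL (R : realType) : set expansion :=
  [set b | deficient_digit_set b /\
    (0 < hausdorff_dim (expansion_val R @` local_level_set b))%E].

(* Main.v *)
(* Concatenate Dyck words of a fixed length L = 2^p: the resulting expansions are
   deficient and all multiples of L are balance points. Every word of even
   length L becomes a Dyck word after flipping a prefix and then rotating, so
   there are at least 2^L / (L+1)^2 Dyck words of length L, enough to encode
   q = L - 2p - 2 free bits in each chunk. As no chunk is constant, the map from
   an encoded expansion back to its free bits is Hoelder of exponent q / L with
   image [0,1), so the encoded expansions have dimension at least q / L, which
   tends to 1. Flipping the chunks of one of them independently stays in its
   local level set and encodes one bit per chunk, whence a local level set of
   dimension at least 1 / L. *)

Require Import Defs.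
From mathcomp Require Import all_boot all_order all_algebra.
From mathcomp Require Import all_classical all_reals all_analysis.
From mathcomp Require Import zify ring lra.
Import Order.TTheory GRing.Theory Num.Theory.
Import numFieldNormedType.Exports.

Local Open Scope classical_set_scope.
Local Open Scope ring_scope.

(** * Binary expansions *)

Section ExpansionValue.
Context {R : realType}.
Implicit Types (b c : expansion) (i n : nat).

Definition shift b : expansion := fun i => b i.+1.

Definition partial_val b : R^nat :=
  series (fun i => (b i)%:R / 2 ^+ i.+1 : R).

Lemma partial_valS b n :
  partial_val b n.+1 = partial_val b n + (b n)%:R / 2 ^+ n.+1.
Proof. by rewrite /partial_val /series /= big_nat_recr. Qed.

Lemma partial_val_shift b n :
  partial_val b n.+1 = ((b 0%N)%:R + partial_val (shift b) n) / 2.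
Proof.
rewrite /partial_val /series /= big_nat_recl// mulrDl expr1; congr (_ + _).
rewrite mulr_suml; apply: eq_bigr => i _.
by rewrite [in LHS]exprSr invfM mulrA.
Qed.

Lemma digit_ge0 b i : 0 <= (b i)%:R / 2 ^+ i.+1 :> R.
Proof. by rewrite divr_ge0// exprn_ge0. Qed.

Lemma partial_val_ndecr b : nondecreasing_seq (partial_val b).
Proof.
by apply/nondecreasing_seqP => n; rewrite partial_valS lerDl digit_ge0.
Qed.

(** The bound [1] is not inductive; this one leaves room for the digits still to come. *)
Lemma partial_val_le b n : partial_val b n <= 1 - 2^-1 ^+ n.
Proof.
elim: n => [|n IH].
  by rewrite /partial_val /series /= big_nil expr0 subrr.
rewrite partial_valS; move: IH; rewrite -exprVn !exprS.
have : (b n)%:R <= 1 :> R by case: (b n).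
have : 0 <= 2^-1 ^+ n :> R by rewrite exprn_ge0.
by nra.
Qed.

Lemma partial_val_le1 b n : partial_val b n <= 1.
Proof.
apply: (le_trans (partial_val_le b n)).
by rewrite lerBlDr lerDl exprn_ge0.
Qed.

Lemma is_cvg_partial_val b : cvgn (partial_val b).
Proof.
apply: nondecreasing_is_cvgn; first exact: partial_val_ndecr.
by exists 1 => _ [n _ <-]; exact: partial_val_le1.
Qed.

Lemma expansion_val_le1 b : expansion_val R b <= 1.
Proof.
apply: limr_le; first exact: is_cvg_partial_val.
by apply: nearW => n; exact: partial_val_le1.
Qed.

Lemma expansion_val_ge0 b : 0 <= expansion_val R b.
Proof.
have := nondecreasing_cvgn_le (partial_val_ndecr b) (is_cvg_partial_val b) 0%N.
by rewrite /partial_val /series /= big_nil.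
Qed.

Lemma expansion_val_rec b :
  expansion_val R b = ((b 0%N)%:R + expansion_val R (shift b)) / 2.
Proof.
apply/cvg_lim => //; rewrite -/(partial_val b) -(cvg_shiftS (partial_val b)).
rewrite (_ : (fun n => _) =
  (fun n => ((b 0%N)%:R + partial_val (shift b) n) / 2)); last first.
  by apply/funext => n; rewrite partial_val_shift.
apply: cvgM; last exact: cvg_cst.
apply: cvgD; first exact: cvg_cst.
exact: is_cvg_partial_val.
Qed.

Lemma expansion_val_agree b c n : (forall i, (i < n)%N -> b i = c i) ->
  `|expansion_val R b - expansion_val R c| <= 2^-1 ^+ n.
Proof.
elim: n b c => [|n IH] b c bc.
  rewrite expr0 ler_norml.
  have := expansion_val_le1 b; have := expansion_val_le1 c.
  have := expansion_val_ge0 b; have := expansion_val_ge0 c; lra.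
rewrite expansion_val_rec [expansion_val _ c]expansion_val_rec bc//.
rewrite -mulrBl opprD addrACA subrr add0r normrM exprSr.
rewrite [`|2^-1|]gtr0_norm ?invr_gt0//.
by rewrite ler_wpM2r// IH// => i; rewrite /shift => ?; rewrite bc.
Qed.

Lemma expansion_val_digit b n : b n -> 2^-1 ^+ n.+1 <= expansion_val R b.
Proof.
elim: n b => [|n IH] b bn; rewrite expansion_val_rec.
  by rewrite bn expr1 -[leLHS]mul1r ler_wpM2r// lerDl expansion_val_ge0.
by rewrite exprSr ler_wpM2r// ler_wpDl// IH.
Qed.

(** A first difference at [j] alone gives no gap, since 0.1000... = 0.0111...: the tail of [c] can
    make up for the digit [b j]. It cannot also make up for a later one of [b] at [n]. *)
Lemma expansion_val_gap b c j n : (forall i, (i < j)%N -> b i = c i) ->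
  b j -> ~~ c j -> (j < n)%N -> b n ->
  2^-1 ^+ n.+1 <= expansion_val R b - expansion_val R c.
Proof.
elim: j b c n => [|j IH] b c [//|n] bc bj cj jn bn;
    rewrite expansion_val_rec [expansion_val _ c]expansion_val_rec -mulrBl.
  rewrite bj (negbTE cj) exprSr ler_wpM2r// mulr1n mulr0n.
  have := @expansion_val_digit (shift b) n bn.
  have := expansion_val_le1 (shift c); lra.
rewrite bc// opprD addrACA subrr add0r exprSr ler_wpM2r//.
by apply: IH => // i ij; exact: bc.
Qed.

Lemma expansion_val_surj (x : R) :
  0 <= x < 1 -> exists b, expansion_val R b = x.
Proof.
(* Iterates of the doubling map modulo 1; the digit [b n] records the overflow. *)
move=> x01; pose r := fix r n := if n is m.+1 then
  2 * r m - (1 <= 2 * r m)%R%:R else x : R.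
pose b n := (1 <= 2 * r n).
have rS n : r n.+1 = 2 * r n - (b n)%:R by [].
have r01 n : 0 <= r n < 1.
  elim: n => [//|n /andP[? ?]]; rewrite rS /b.
  by case: (leP 1 (2 * r n)) => ?; rewrite ?mulr1n ?mulr0n; lra.
have pE n : partial_val b n = x - r n * 2^-1 ^+ n.
  elim: n => [|n IH].
    by rewrite /partial_val /series /= big_nil expr0 mulr1 subrr.
  rewrite partial_valS IH rS -exprVn exprS; set e := _ ^+ n.
  by field.
exists b; apply/cvg_lim => //; rewrite -/(partial_val b).
have -> : partial_val b = (fun n => x - r n * 2^-1 ^+ n) by exact/funext.
rewrite -[in X in _ --> X](subr0 x); apply: cvgB; first exact: cvg_cst.
apply: (@squeeze_cvgr _ _ _ _ (fun=> 0) (fun n => 2^-1 ^+ n)).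
- apply: nearW => n; have /andP[r0 r1] := r01 n.
  by rewrite mulr_ge0 ?exprn_ge0//= ler_piMl ?exprn_ge0// ltW.
- exact: cvg_cst.
- apply: cvg_expr; rewrite gtr0_norm ?invr_gt0//; lra.
Qed.

End ExpansionValue.

(** * Hausdorff dimension *)

Section HausdorffDimension.
Context {R : realType}.
Implicit Types (A B : set R) (s : R).
Local Open Scope ereal_scope.

Lemma diam_ge0 A : 0 <= diam A.
Proof. by apply: ereal_sup_ubound; left. Qed.

Lemma dist_le_diam A (x y : R) : A x -> A y -> (`|x - y|)%:E <= diam A.
Proof. by move=> Ax Ay; apply: ereal_sup_ubound; right; exists (x, y). Qed.

Lemma diam_le A (d : R) : (0 <= d)%R ->
  (forall x y, A x -> A y -> `|x - y| <= d)%R -> diam A <= d%:E.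
Proof.
move=> d0 Ad; apply: ge_ereal_sup => _ [->|[[x y] /= [Ax Ay] <-]].
  by rewrite lee_fin.
by rewrite lee_fin; exact: Ad.
Qed.

Lemma diam_weight_ge0 s A : 0 <= diam_weight s A.
Proof. by rewrite /diam_weight; case: ifP => // _; exact: poweR_ge0. Qed.

Lemma hausdorff_premeasure_ge0 s (delta : R) A :
  0 <= hausdorff_premeasure s delta A.
Proof.
apply: le_ereal_inf_tmp => _ [U _ <-].
by apply: nneseries_ge0 => n _ _; exact: diam_weight_ge0.
Qed.

Lemma hausdorff_measure0P s A :
  hausdorff_measure s A = 0 <->
  forall delta : R, (0 < delta)%R -> hausdorff_premeasure s delta A = 0.
Proof.
split=> [HA delta d0|HA]; apply/eqP; rewrite eq_le.
  rewrite hausdorff_premeasure_ge0 andbT -HA.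
  by apply: ereal_sup_ubound; exists delta.
apply/andP; split.
  by apply: ge_ereal_sup => _ [delta d0 <-]; rewrite HA.
by rewrite -(HA 1%R ltr01); apply: ereal_sup_ubound; exists 1%R => //=.
Qed.

Lemma hausdorff_premeasure_sub s (delta : R) A B : A `<=` B ->
  hausdorff_premeasure s delta A <= hausdorff_premeasure s delta B.
Proof.
move=> AB; apply: ereal_inf_le_tmp => _ [U [BU dU] <-].
by exists U => //; split => //; exact: subset_trans BU.
Qed.

Lemma hausdorff_dim_sub A B : A `<=` B -> hausdorff_dim A <= hausdorff_dim B.
Proof.
move=> AB; apply: ereal_inf_le_tmp => _ [s [s0 sB] <-].
exists s => //; split => //; apply/hausdorff_measure0P => delta d0.
apply/eqP; rewrite eq_le hausdorff_premeasure_ge0 andbT.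
move/hausdorff_measure0P/(_ delta d0) : sB => <-.
exact: hausdorff_premeasure_sub.
Qed.

(** About [1 / h] intervals of length [h] have total weight about [h ^ (s - 1)], which tends to 0
    with [h]. *)
Lemma hausdorff_measure_unit_itv s : (1 < s)%R ->
  hausdorff_measure s (`[0%R, 1%R]%classic : set R) = 0.
Proof.
move=> s1; apply/hausdorff_measure0P => delta d0.
apply/eqP; rewrite eq_le hausdorff_premeasure_ge0 andbT.
apply/lee_addgt0Pr => _ /posnumP[e]; rewrite add0e.
pose t := (s - 1)%R; have t0 : (0 < t)%R by rewrite /t; lra.
(* The first bound makes the cover admissible, the second gives [h ^ (s - 1) <= e / 2]; the other
   half of [e] absorbs the factor [n.+2 * h <= 2]. *)
pose eta := Num.min delta ((e%:num / 2) `^ t^-1)%R.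
have eta0 : (0 < eta)%R by rewrite lt_min d0 powR_gt0.
have [n neta] : exists n, (n.+1%:R^-1 < eta)%R.
  exists (Num.truncn eta^-1).
  by rewrite -[ltRHS]invrK ltf_pV2 ?posrE ?invr_gt0// truncnS_gt.
pose h : R := (n.+1%:R^-1)%R.
have h0 : (0 < h)%R by rewrite invr_gt0.
have nh : (n.+1%:R * h = 1)%R by rewrite mulfV// pnatr_eq0.
(* One interval more than the [n.+1] needed for length 1: the point 1 has index [n.+1]. *)
pose U i : set R := if (i < n.+2)%N then
  `[(i%:R * h)%R, (i.+1%:R * h)%R]%classic else set0.
have dU i : diam (U i) <= h%:E.
  apply: diam_le => [|x y]; first exact: ltW.
  rewrite /U; case: ifP => // _; rewrite /= !in_itv/= -natr1 mulrDl mul1r.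
  move=> /andP[? ?] /andP[? ?]; rewrite ler_norml; lra.
have wU i : diam_weight s (U i) <= (h `^ s)%:E.
  rewrite /diam_weight; case: ifP => _; first by rewrite lee_fin powR_ge0.
  rewrite -poweR_EFin; apply: gt0_ler_poweR => //; first by lra.
  - by rewrite in_itv/= diam_ge0 leey.
  - by rewrite in_itv/= lee_fin leey ltW.
apply: (@le_trans _ _ (\sum_(0 <= i <oo) diam_weight s (U i))).
  apply: ereal_inf_lbound; exists U => //; split.
    move=> x /=; rewrite in_itv/= => /andP[x0 x1].
    have x0' : (0 <= x * n.+1%:R)%R by rewrite mulr_ge0.
    have := truncn_itv x0'; set i := Num.truncn _ => /andP[ix xi].
    have iN : (i < n.+2)%N.
      rewrite ltnS -(ler_nat R) (le_trans ix)// -[leRHS]mul1r.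
      by rewrite ler_wpM2r.
    exists i => //; rewrite /U iN /= in_itv/=.
    have -> : x = (x * n.+1%:R * h)%R by rewrite -mulrA nh mulr1.
    by rewrite !ler_wpM2r// ltW.
  move=> i; apply: (le_trans (dU i)); rewrite lee_fin.
  by apply: ltW; apply: (lt_le_trans neta); rewrite ge_min lexx.
rewrite (nneseries_split 0 n.+2); last by move=> *; exact: diam_weight_ge0.
rewrite eseries0 ?adde0; last first.
  by move=> i ni _; rewrite /U ltnNge ni /= /diam_weight eqxx.
apply: (@le_trans _ _ (\sum_(0 <= i < 0 + n.+2) (h `^ s)%:E)).
  by apply: lee_sum => i _; exact: wU.
rewrite sumEFin lee_fin sumr_const_nat subn0 add0n -mulr_natl.
rewrite -mulr_powRB1 ?(ltW h0)//; last by lra.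
rewrite -/t mulrA.
have ht : (h `^ t <= e%:num / 2)%R.
  have -> : (e%:num / 2 = (e%:num / 2) `^ t^-1 `^ t)%R.
    by rewrite -powRrM mulVf ?gt_eqF// powRr1.
  apply: ge0_ler_powR; rewrite ?nnegrE ?powR_ge0 ?ltW//.
  by apply: (lt_le_trans neta); rewrite ge_min lexx orbT.
have h1 : (h <= 1)%R by rewrite invf_le1 ?ler1n.
have n2h : (n.+2%:R * h <= 2)%R by rewrite -natr1 mulrDl nh mul1r; lra.
have -> : (e%:num = 2 * (e%:num / 2))%R by rewrite mulrC divfK.
by apply: ler_pM => //; rewrite ?mulr_ge0 ?powR_ge0 ?(ltW h0).
Qed.

Lemma hausdorff_dim_le1 A : A `<=` `[0%R, 1%R]%classic -> hausdorff_dim A <= 1.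
Proof.
move=> /hausdorff_dim_sub /le_trans; apply.
apply/lee_addgt0Pr => e e0; apply: ereal_inf_lbound; exists (1 + e)%R => //.
split; first by lra.
by apply: hausdorff_measure_unit_itv; lra.
Qed.

(* The inverse of the parametrization [b |-> G b] is Hoelder with exponent
   [s0], so it sends a cover of [A] with small weight to a cover of [0, 1[
   with small Lebesgue measure. *)
Lemma hausdorff_dim_hoelder A (G : expansion -> expansion) (s0 C : R) :
  (0 < C)%R -> (forall b, A (expansion_val R (G b))) ->
  (forall b c, `|expansion_val R b - expansion_val R c| <=
    C * `|expansion_val R (G b) - expansion_val R (G c)| `^ s0)%R ->
  s0%:E <= hausdorff_dim A.
Proof.
move=> C0 AG hG.
apply: le_ereal_inf_tmp => _ [s [sge0 /hausdorff_measure0P sA] <-].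
rewrite lee_fin leNgt; apply/negP => ss0.
(* Distances between values are at most 1, so lowering the exponent from [s0] to [s] weakens the
   inequality. *)
have {}hG b c : (`|expansion_val R b - expansion_val R c| <=
    C * `|expansion_val R (G b) - expansion_val R (G c)| `^ s)%R.
  apply: (le_trans (hG b c)); rewrite ler_wpM2l ?(ltW C0)//.
  set d := `|expansion_val R (G b) - _|%R.
  have d1 : (d <= 1)%R by rewrite -(expr0 2^-1); exact: expansion_val_agree.
  have [->|dN0] := eqVneq d 0%R.
    have s0N0 : s0 != 0%R by rewrite gt_eqF// (le_lt_trans sge0).
    by rewrite (powR0 s0N0) powR_ge0.
  by apply: ger_powR; rewrite ?(ltW ss0)// d1 andbT lt_neqAle eq_sym dN0 normr_ge0.
have := sA 1%R ltr01 => sA1.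
(* The intervals [J i] below have length at most [2 * C] times the weight of [U i], so this
   threshold keeps their total length under 1/2, too short to cover [0, 1). *)
have /ereal_inf_lt[_ [U [AU dU] <-] wU] :
  hausdorff_premeasure s 1 A < ((4 * C)^-1)%:E.
  by rewrite sA1 lte_fin invr_gt0 mulr_gt0.
have fU i : diam (U i) \is a fin_num.
  rewrite ge0_fin_numE; last exact: diam_ge0.
  by rewrite (le_lt_trans (dU i)) ?ltry.
pose r i := (C * (fine (diam (U i))) `^ s)%R.
have r0 i : (0 <= r i)%R by rewrite mulr_ge0 ?powR_ge0 ?(ltW C0).
have /choice[a aP] : forall i, exists a : R, forall b,
    U i (expansion_val R (G b)) -> (`|expansion_val R b - a| <= r i)%R.
  move=> i.
  have [[c Uc]|nU] := pselect (exists c, U i (expansion_val R (G c))).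
    exists (expansion_val R c) => b Ub.
    apply: (le_trans (hG _ _)); rewrite ler_wpM2l ?(ltW C0)//.
    apply: ge0_ler_powR => //; rewrite ?nnegrE//.
      by rewrite -lee_fin fineK// diam_ge0.
    by rewrite -lee_fin fineK// dist_le_diam.
  by exists 0%R => b Ub; case: nU; exists b.
(* The empty case is split off to match [diam_weight]: for [s = 0] the radius [r i] of an empty
   [U i] would be [C], against weight 0. *)
pose J i : set R := if U i == set0 then set0 else
  `[(a i - r i)%R, (a i + r i)%R]%classic.
have mJ i : measurable (J i) by rewrite /J; case: ifP.
have lJ i : lebesgue_measure (J i) <= (2 * C)%:E * diam_weight s (U i).
  rewrite /J /diam_weight; case: ifP => _; first by rewrite measure0 mule0.
  rewrite lebesgue_measure_itv/= lte_fin -{1}(fineK (fU i)) poweR_EFin -EFinM.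
  case: ifP => _; last by rewrite lee_fin !mulr_ge0 ?powR_ge0 ?(ltW C0).
  rewrite -EFinD lee_fin /r; lra.
have JU : `[0%R, 1%R[ `<=` \bigcup_i J i.
  move=> x /=; rewrite in_itv/= => /expansion_val_surj[b bx].
  have [i _ Ui] := AU _ (AG b); exists i => //; rewrite /J.
  case: ifPn => [/eqP U0|_]; first by move: Ui; rewrite U0.
  by have := aP i b Ui; rewrite bx /= in_itv/= ler_norml => /andP[? ?]; lra.
have : lebesgue_measure (`[0%R, 1%R[%classic : set R) <=
    \sum_(0 <= i <oo) lebesgue_measure (J i).
  exact: measure_sigma_subadditive.
rewrite lebesgue_measure_itv/= lte_fin ltr01 oppr0 adde0 leNgt => /negP; apply.
apply: (@le_lt_trans _ _ (\sum_(0 <= i <oo) (2 * C)%:E * diam_weight s (U i))).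
  by apply: lee_nneseries => *; [exact: measure_ge0 | exact: lJ].
rewrite nneseriesZl; last by move=> *; exact: diam_weight_ge0.
apply: (@lt_le_trans _ _ ((2 * C)%:E * ((4 * C)^-1)%:E)).
  by rewrite lte_pmul2l// lte_fin mulr_gt0.
rewrite -EFinM lee_fin ler_pdivrMr ?mulr_gt0//; lra.
Qed.

End HausdorffDimension.

(** * Dimension bounds from chunkwise codes *)

Section Coding.
Context {R : realType}.

(** If [G b] and [G c] first differ in chunk [k], then [b] and [c] share [k * q] digits, while a one
    in chunk [k.+1] keeps the coded values [2^-1 ^+ (k.+2 * n)] apart. This is a Hoelder bound of
    exponent [q / n], and the two extra chunks cost the constant [2 ^+ (2 * q)]. *)
Lemma hausdorff_dim_code (A : set R) (G : expansion -> expansion) (q n : nat) :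
  (0 < n)%N -> (forall b, A (expansion_val R (G b))) ->
  (forall b k, exists2 j, (k * n <= j < k.+1 * n)%N & G b j) ->
  (forall b c k, (forall j, (j < k * n)%N -> G b j = G c j) ->
    forall i, (i < k * q)%N -> b i = c i) ->
  ((q%:R / n%:R)%:E <= hausdorff_dim A)%E.
Proof.
(* For [q = 0] the decoding hypothesis is void, but the bound is just nonnegativity of the
   dimension. *)
move=> n0 AG G1 Ginj; have [->|q0] := posnP q.
  by rewrite mul0r; apply: le_ereal_inf_tmp => _ [s [s0 _] <-]; rewrite lee_fin.
apply: (@hausdorff_dim_hoelder _ _ G _ (2 ^+ (2 * q))) => // b c.
have [[j0 bcj0]|bc] := pselect (exists j, G b j != G c j); last first.
  have -> : b = c.
    apply/funext => i; apply: (Ginj b c i.+1); last by nia.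
    by move=> j _; apply/eqP/negPn/negP => bcj; apply: bc; exists j.
  by rewrite subrr normr0 mulr_ge0 ?exprn_ge0 ?powR_ge0.
have exj : exists j, G b j != G c j by exists j0.
case: (ex_minnP exj) => j bcj jmin.
have bcltj i : (i < j)%N -> G b i = G c i.
  move=> ij; apply/eqP/negPn/negP => /jmin; lia.
set k := (j %/ n)%N.
have jk : (k * n <= j < k.+1 * n)%N by rewrite leq_trunc_div /= ltn_ceil.
have bck : `|expansion_val R b - expansion_val R c| <= 2^-1 ^+ (k * q).
  apply: expansion_val_agree; apply: Ginj => i ik; apply: bcltj; lia.
(* Chunk [k] may have its ones only up to [j]; chunk [k.+1] lies wholly after [j]. *)
have gap x y : (forall i, (i < j)%N -> G x i = G y i) -> G x j -> ~~ G y j ->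
    2^-1 ^+ (k.+2 * n) <= `|expansion_val R (G x) - expansion_val R (G y)|.
  move=> xy xj yj; have [i ik xi] := G1 x k.+1.
  apply: le_trans (ler_norm _).
  apply: le_trans (@expansion_val_gap R _ _ _ i xy xj yj _ xi); last by lia.
  by apply: ler_wiXn2l; rewrite ?invf_le1 ?ler1n//; lia.
have {}gap : 2^-1 ^+ (k.+2 * n) <=
    `|expansion_val R (G b) - expansion_val R (G c)|.
  move: bcj; case bj: (G b j); case cj: (G c j) => // _.
    by apply: gap; rewrite ?bj ?cj.
  by rewrite distrC; apply: gap; rewrite ?bj ?cj// => i /bcltj.
apply: (le_trans bck).
apply: (@le_trans _ _ (2 ^+ (2 * q) * (2^-1 ^+ (k.+2 * n)) `^ (q%:R / n%:R))).
  rewrite -[X in X `^ _]powR_mulrn// -powRrM natrM.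
  rewrite -mulrA [n%:R * _]mulrC divfK ?pnatr_eq0 -?lt0n// -natrM powR_mulrn//.
  have -> : (k.+2 * q = k * q + 2 * q)%N by lia.
  rewrite exprD [X in _ * (_ * X)]exprVn mulrCA.
  by rewrite mulfV ?mulr1// expf_eq0 pnatr_eq0 andbF.
rewrite ler_wpM2l ?exprn_ge0//.
by apply: ge0_ler_powR; rewrite ?nnegrE ?exprn_ge0 ?normr_ge0 ?divr_ge0.
Qed.

End Coding.

(** * Dyck words *)

Section DyckWords.
Local Open Scope nat_scope.
Implicit Types (s : seq bool) (i j : nat).

Definition dyck s :=
  ((count id s).*2 == size s) &&
  all (fun j => (count id (take j s)).*2 <= j) (iota 0 (size s)).

Lemma dyck_take s j : dyck s -> j <= size s -> (count id (take j s)).*2 <= j.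
Proof.
move=> /andP[/eqP s2 /allP sall]; rewrite leq_eqVlt => /orP[/eqP ->|js].
  by rewrite take_size s2.
by apply: sall; rewrite mem_iota.
Qed.

Definition flip_prefix i s := map negb (take i s) ++ drop i s.

Lemma size_flip_prefix i s : size (flip_prefix i s) = size s.
Proof. by rewrite size_cat size_map -size_cat cat_take_drop. Qed.

Lemma flip_prefixK i : involutive (flip_prefix i).
Proof.
move=> s; rewrite /flip_prefix.
have [si|lt_is] := leqP (size s) i.
  rewrite (take_oversize si) (drop_oversize si) cats0.
  by rewrite take_oversize ?drop_oversize ?size_map// cats0 (mapK negbK).
have sz : size (map negb (take i s)) = i by rewrite size_map size_takel // ltnW.
rewrite take_size_cat// drop_size_cat// (mapK negbK); exact: cat_take_drop.
Qed.

(** Lengthening the flipped prefix changes at most one letter: the discrete continuity behind the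
    balancing argument. *)
Lemma count_flip_prefixS i s :
  count id (flip_prefix i.+1 s) <= (count id (flip_prefix i s)).+1 /\
  count id (flip_prefix i s) <= (count id (flip_prefix i.+1 s)).+1.
Proof.
rewrite /flip_prefix; have [si|si] := leqP (size s) i.
  rewrite !take_oversize ?drop_oversize//; lia.
rewrite (drop_nth false si) (take_nth false si) map_rcons -cats1 !count_cat /=.
by case: (nth _ _ _) => /=; lia.
Qed.

Lemma nat_ivt (f : nat -> nat) m N : (forall i, f i.+1 <= (f i).+1) ->
  f 0 <= m <= f N -> exists2 i, i <= N & f i = m.
Proof.
move=> fS; elim: N => [|N IH] fm; first by exists 0; lia.
have [fN|fN] := leqP m (f N).
  by have [|i iN fi] := IH; [lia | exists i; lia].
exists N.+1 => //; have := fS N; lia.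
Qed.

(** As the flipped prefix grows from nothing to all of [s], the count of ones moves in unit steps to
    its reflection about half the size, so it hits the half. *)
Lemma flip_prefix_balanced s : ~~ odd (size s) ->
  exists2 i, i <= size s & (count id (flip_prefix i s)).*2 = size s.
Proof.
move=> s2; have f0 : flip_prefix 0 s = s by rewrite /flip_prefix take0 drop0.
have fs : count id (flip_prefix (size s) s) = size s - count id s.
  rewrite /flip_prefix take_size drop_size cats0 count_map.
  by rewrite -(count_predC id s) addKn.
have cs : count id s <= size s by exact: count_size.
have [le_s|lt_s] := leqP (count id s).*2 (size s).
  have [||i iN fi] := @nat_ivt (fun i => count id (flip_prefix i s))
    (size s)./2 (size s).
  - by move=> i; have [] := count_flip_prefixS i s.
  - by rewrite f0 fs; lia.
  - by exists i => //; rewrite fi; lia.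
(* Starting from too many ones, the count of zeros is what climbs to the half. *)
have [||i iN fi] := @nat_ivt (fun i => size s - count id (flip_prefix i s))
  (size s)./2 (size s).
- by move=> i; have [_] := count_flip_prefixS i s; lia.
- by rewrite f0 fs; lia.
- exists i => //; have := count_size id (flip_prefix i s).
  by rewrite size_flip_prefix; lia.
Qed.

(* Cutting at the highest point of the walk "ones minus zeros". *)
Lemma rot_dyck s : (count id s).*2 = size s ->
  exists2 i, i <= size s & dyck (rot i s).
Proof.
(* The height of the walk after [i] steps, shifted by [size s] to stay in the naturals. *)
move=> s2; pose h i := (count id (take i s)).*2 + (size s - i).
have [i _ imax] := @arg_maxnP 'I_(size s).+1 ord0 xpredT (h \o val) isT.
have iS : i <= size s by rewrite -ltnS ltn_ord.
have {}imax j : j <= size s -> h j <= h i.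
  by move=> js; exact: (imax (Ordinal (js : j < (size s).+1))).
exists i => //; rewrite /dyck size_rot.
have -> : count id (rot i s) = count id s.
  by apply/permP; exact: permEl (perm_rot _ _).
rewrite s2 eqxx /=; apply/allP => j; rewrite mem_iota => /andP[_ js].
have csd : count id s = count id (take i s) + count id (drop i s).
  by rewrite -count_cat cat_take_drop.
(* A prefix of the rotated word either ends inside [drop i s] or wraps around; in the second case
   the total height 0 of [s] enters. *)
rewrite /rot take_cat size_drop; case: ltnP => ji.
  have := imax (i + j); rewrite /h takeD count_cat; lia.
rewrite count_cat take_takel; last by lia.
have := imax (j - (size s - i)); rewrite /h; lia.
Qed.

(** Undoing a rotation and then a prefix flip reaches every word from some Dyck word, so [F] is
    onto; each of the two operations has [L.+1] parameters. *)
Lemma card_dyck L : ~~ odd L ->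
  2 ^ L <= L.+1 ^ 2 * #|[set w : L.-tuple bool | dyck w]%SET|.
Proof.
move=> L2; set D := [set w : L.-tuple bool | dyck w]%SET.
pose F (u : 'I_L.+1 * 'I_L.+1 * L.-tuple bool) : L.-tuple bool :=
  insubd u.2 (flip_prefix u.1.1 (rotr u.1.2 u.2)).
have -> : 2 ^ L = #|{: L.-tuple bool}| by rewrite card_tuple card_bool.
have -> : L.+1 ^ 2 * #|D| =
    #|finset.setX (finset.setX [set: 'I_L.+1]%SET [set: 'I_L.+1]%SET) D|.
  by rewrite !cardsX !cardsT card_ord mulnn.
apply: leq_trans (leq_imset_card F _); rewrite -cardsT.
apply/subset_leq_card/fintype.subsetP => w _.
have [|i iL fi] := @flip_prefix_balanced w; first by rewrite size_tuple.
have [|j jL dj] := @rot_dyck (flip_prefix i w); first by rewrite size_flip_prefix.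
have sz : size (rot j (flip_prefix i w)) == L.
  by rewrite size_rot size_flip_prefix size_tuple.
move: iL jL; rewrite size_flip_prefix size_tuple => iL jL.
apply/imsetP; exists (Ordinal (iL : i < L.+1), Ordinal (jL : j < L.+1), Tuple sz).
  by rewrite !inE.
by apply: val_inj; rewrite /F /= val_insubd rotK flip_prefixK size_tuple eqxx.
Qed.

Lemma dyck_code p : 0 < p ->
  exists2 e : (2 ^ p - p.*2 - 2).-tuple bool -> (2 ^ p).-tuple bool,
    injective e & forall u, dyck (e u).
Proof.
move=> p0; set q := 2 ^ p - _ - _; set L := 2 ^ p.
have L2 : ~~ odd L by rewrite oddX; case: p p0 @q @L.
pose D := [set w : L.-tuple bool | dyck w]%SET.
have qD : 2 ^ q <= #|D|.
  (* The subtraction defining [q] may have been truncated; when [q = 0] a single Dyck word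
     suffices. *)
  have [q0|q0] := posnP q.
    rewrite q0 expn0.
    have := card_dyck _ L2; rewrite -/D; case: #|D| => //.
    by rewrite muln0 leqNgt expn_gt0.
  rewrite -(@leq_pmul2l (2 ^ (p.*2 + 2))) ?expn_gt0// -expnD.
  have -> : p.*2 + 2 + q = L by rewrite /q /L in q0 *; lia.
  apply: (leq_trans (card_dyck _ L2)); rewrite leq_mul2r; apply/orP; right.
  (* Here [L.+1 <= 2 * L = 2 ^ p.+1], whose square is the factor lost. *)
  have -> : p.*2 + 2 = p.+1 * 2 by lia.
  have L0 : 0 < L by rewrite expn_gt0.
  by rewrite expnM leq_exp2r// expnS -/L; lia.
have sD : size (enum D) = #|D| by rewrite -cardE.
have rD (u : q.-tuple bool) : enum_rank u < size (enum D).
  rewrite sD (leq_trans _ qD)// -[in X in _ < X]card_bool -card_tuple.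
  by rewrite (leq_trans (ltn_ord _)).
pose w0 : L.-tuple bool := nseq_tuple L false.
exists (fun u => nth w0 (enum D) (enum_rank u)).
  move=> u v /eqP; rewrite nth_uniq ?enum_uniq// => /eqP uv.
  by apply: enum_rank_inj; exact: val_inj.
by move=> u; have := mem_nth w0 (rD u); rewrite mem_enum inE.
Qed.

End DyckWords.

(** * Balance points and local level sets *)

Section Deficiency.
Local Open Scope nat_scope.
Implicit Types (b : expansion) (L j : nat).

Definition ones b j := \sum_(i < j) b i.

Lemma onesS b j : ones b j.+1 = ones b j + b j.
Proof. by rewrite /ones big_ord_recr. Qed.

Lemma deficiency_eq0 b j : (deficiency b j == 0%R) = ((ones b j).*2 == j).
Proof. by rewrite /deficiency -/(ones b j); lia. Qed.

Lemma deficiency_ge0 b j : (0 <= deficiency b j)%R = ((ones b j).*2 <= j).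
Proof. by rewrite /deficiency -/(ones b j); lia. Qed.

(** Each chunk starts at a balance point, so inside it the walk is that of its Dyck word, which
    stays nonnegative and returns to 0. *)
Lemma dyck_chunks b L (w : nat -> seq bool) : 0 < L ->
  (forall k, size (w k) = L /\ dyck (w k)) ->
  (forall k r, r < L -> b (k * L + r) = nth false (w k) r) ->
  (forall k, deficiency b (k * L) = 0%R) /\ deficient_digit_set b.
Proof.
move=> L0 wP bw.
have wr k r : (ones b (k * L)).*2 = k * L -> r <= L ->
    ones b (k * L + r) = ones b (k * L) + count id (take r (w k)).
  move=> bk; elim: r => [|r IH] rL; first by rewrite take0 !addn0.
  have [sw _] := wP k.
  rewrite addnS onesS (IH (ltnW rL)) (bw _ _ rL) -addnA.
  by rewrite (take_nth false) ?sw// -cats1 count_cat /= addn0.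
have bk k : (ones b (k * L)).*2 = k * L.
  elim: k => [|k IH]; first by rewrite /ones big_ord0.
  have [sw /andP[/eqP dw _]] := wP k.
  by rewrite mulSnr wr// -{2}sw take_size; lia.
split=> [k|j _]; first by apply/eqP; rewrite deficiency_eq0 bk.
rewrite deficiency_ge0 (divn_eq j L) wr ?(ltnW (ltn_pmod _ _))//.
have [sw dw] := wP (j %/ L).
have := @dyck_take _ (j %% L) dw; have := bk (j %/ L); have := ltn_pmod j L0.
rewrite sw; lia.
Qed.

End Deficiency.

(** * Independent chunk flips inside one local level set *)

Section LocalLevelSet.
Local Open Scope nat_scope.
Context (x : expansion) (L : nat).
Context (L0 : 0 < L) (xL : forall k, deficiency x (k * L) = 0%R).
Implicit Types (e : expansion) (i j k r c : nat).

Definition flip_chunks e : expansion := fun i => x i (+) e (i %/ L).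

Let xk k : (ones x (k * L)).*2 = k * L.
Proof. by apply/eqP; rewrite -deficiency_eq0 xL. Qed.

Lemma flip_chunksE e k r : r < L ->
  flip_chunks e (k * L + r) = x (k * L + r) (+) e k.
Proof. by move=> rL; rewrite /flip_chunks divnMDl// divn_small// addn0. Qed.

(** Starting from balance, flipping a chunk reflects the walk: the two counts of ones sum to the
    position exactly when the deficiencies are opposite. *)
Lemma ones_flip_chunks e k r : (ones (flip_chunks e) (k * L)).*2 = k * L ->
  r <= L ->
  if e k then ones (flip_chunks e) (k * L + r) + ones x (k * L + r) = k * L + r
  else ones (flip_chunks e) (k * L + r) = ones x (k * L + r).
Proof.
move=> fk; elim: r => [|r IH] rL.
  by rewrite addn0; have := xk k; case: (e k); lia.
move: (IH (ltnW rL)); rewrite addnS !onesS flip_chunksE//.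
by case: (e k); case: (x _) => /=; lia.
Qed.

Lemma balanced_flip_chunks e k : (ones (flip_chunks e) (k * L)).*2 = k * L.
Proof.
elim: k => [|k IH]; first by rewrite /ones big_ord0.
have := ones_flip_chunks _ _ _ IH (leqnn L); have := xk k.+1.
by rewrite mulSnr; case: (e k); lia.
Qed.

Lemma flip_chunks_deficiency e j :
  (deficiency (flip_chunks e) j == 0%R) = (deficiency x j == 0%R).
Proof.
rewrite !deficiency_eq0 (divn_eq j L).
have := ones_flip_chunks _ _ _ (balanced_flip_chunks e (j %/ L))
  (ltnW (ltn_pmod j L0)).
by case: (e _); lia.
Qed.

Lemma flip_chunks_balance e k : balance (flip_chunks e) k = balance x k.
Proof.
elim: k => [//|k /= ->]; congr obind; apply/funext => c.
(* Making the balance predicate an explicit argument lets extensionality replace it, even though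
   [ex_minn] depends on an existence proof about it. *)
pose first_above (Z : pred nat) :=
  if pselect (exists j, (c < j) && Z j) is left ex then Some (ex_minn ex)
  else None.
rewrite -[LHS]/(first_above (fun j => deficiency (flip_chunks e) j == 0%R)).
rewrite -[RHS]/(first_above (fun j => deficiency x j == 0%R)).
by congr first_above; apply/funext => j; rewrite flip_chunks_deficiency.
Qed.

(* Multiples of [L] are balance points, so no block crosses them. *)
Lemma block_chunk k i c : balance x k = Some c -> c <= i ->
  (forall c', balance x k.+1 = Some c' -> i < c') -> i %/ L = c %/ L.
Proof.
move=> xc ci iB; apply/eqP; rewrite eqn_leq (leq_div2r L ci) andbT leqNgt.
apply/negP => ltci; move: iB; rewrite /= xc /= /next_balance.
have cL : (c < (c %/ L).+1 * L) && (deficiency x ((c %/ L).+1 * L) == 0%R).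
  by rewrite xL eqxx andbT ltn_ceil.
case: pselect => [ex|]; last by case; exists ((c %/ L).+1 * L).
move=> /(_ _ erefl); case: ex_minnP => m _ /(_ _ cL) mc.
rewrite ltnNge (leq_trans mc)//.
by rewrite (leq_trans _ (leq_trunc_div i L))// leq_mul2r ltci orbT.
Qed.

(** Every block lies inside one chunk, so it is flipped as a whole or left alone. *)
Lemma local_equiv_flip_chunks e : local_equiv (flip_chunks e) x.
Proof.
split.
  rewrite /balance_set; apply/seteqP.
  by split=> c [k kc]; exists k; move: kc; rewrite flip_chunks_balance.
move=> k; rewrite /block.
have -> : balance (flip_chunks e) k = balance x k by exact: flip_chunks_balance.
have -> : balance (flip_chunks e) k.+1 = balance x k.+1
  by exact: flip_chunks_balance.
case xc : (balance x k) => [c|]; last first.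
  by left; apply/seteqP; split=> p [i [[? //]]].
have fi i : ((exists2 c0, Some c = Some c0 & c0 <= i) /\
    (forall c0, balance x k.+1 = Some c0 -> i < c0)) ->
    flip_chunks e i = x i (+) e (c %/ L).
  move=> [[_ [<-] ci] iB].
  by rewrite /flip_chunks (block_chunk _ _ _ xc ci iB).
case ec : (e (c %/ L)); [right|left].
  rewrite /flip_block; apply/seteqP; split.
    move=> _ [i iP <-]; exists (i, flip_chunks e i); first by exists i.
    by rewrite /= fi// ec addbT negbK.
  move=> _ [_ [i iP <-] <-]; exists i => //=.
  by rewrite fi// ec addbT negbK.
by apply/seteqP; split=> _ [i iP <-]; exists i; rewrite // fi// ec addbF.
Qed.

(** A chunk of zeros only could not be balanced at both of its ends. *)
Lemma flip_chunks_nonzero e k :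
  exists2 j, k * L <= j < k.+1 * L & flip_chunks e j.
Proof.
have [//|nj] := pselect (exists2 j, k * L <= j < k.+1 * L & flip_chunks e j).
have f0 r : r <= L ->
    ones (flip_chunks e) (k * L + r) = ones (flip_chunks e) (k * L).
  elim: r => [|r IH] rL; first by rewrite addn0.
  rewrite addnS onesS (IH (ltnW rL)).
  case fr: (flip_chunks e _); last by rewrite addn0.
  by case: nj; exists (k * L + r) => //; rewrite leq_addr mulSnr ltn_add2l.
have := f0 L (leqnn L); rewrite -mulSnr.
have := balanced_flip_chunks e k; have := balanced_flip_chunks e k.+1.
by rewrite mulSnr; lia.
Qed.

Lemma hausdorff_dim_local_level_set (R : realType) :
  ((1 / L%:R : R)%:E <= hausdorff_dim (expansion_val R @` local_level_set x))%E.
Proof.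
apply: (@hausdorff_dim_code R _ flip_chunks 1 L) => //.
- by move=> e; exists (flip_chunks e) => //; exact: local_equiv_flip_chunks.
- exact: flip_chunks_nonzero.
- move=> b c k agree i; rewrite muln1 => ik.
  (* The first digit of chunk [i] already reveals the bit [e i], by cancelling the digit of [x]. *)
  have := agree (i * L + 0); rewrite !flip_chunksE// addn0 ltn_mul2r L0 ik.
  by move=> /(_ isT) /addbI.
Qed.

End LocalLevelSet.

(** * The encoding by Dyck words *)

Lemma expansion_val_image_sub (R : realType) (S : set expansion) :
  expansion_val R @` S `<=` `[0, 1]%classic.
Proof.
move=> _ [b _ <-] /=.
by rewrite in_itv/= expansion_val_ge0 expansion_val_le1.
Qed.

Lemma hausdorff_dim_LambdaHL_ge (R : realType) (p : nat) : (0 < p)%N ->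
  (((2 ^ p - p.*2 - 2)%:R / (2 ^ p)%:R : R)%:E <=
   hausdorff_dim (expansion_val R @` LambdaHL R))%E.
Proof.
move=> /dyck_code; set q := (_ - _ - _)%N; set L := (2 ^ p)%N => -[e inje dycke].
have L0 : (0 < L)%N by rewrite expn_gt0.
pose chunk (b : expansion) k := [tuple b (k * q + a)%N | a < q].
pose G b : expansion := fun i => nth false (e (chunk b (i %/ L)%N)) (i %% L).
have GE b k r : (r < L)%N -> G b (k * L + r)%N = nth false (e (chunk b k)) r.
  by move=> rL; rewrite /G divnMDl// divn_small// addn0 modnMDl modn_small.
have GD b := @dyck_chunks (G b) L (fun k => e (chunk b k)) L0
  (fun k => conj (size_tuple _) (dycke _)) (GE b).
apply: (@hausdorff_dim_code R _ G q L) => //.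
- move=> b; exists (G b) => //; split; first exact: (GD b).2.
  apply: lt_le_trans (hausdorff_dim_local_level_set (G b) L L0 (GD b).1 R).
  by rewrite lte_fin divr_gt0 ?ltr0n.
(* Half of the letters of a Dyck word are ones, and [L] is positive. *)
- move=> b k; have /andP[/eqP e2 _] := dycke (chunk b k).
  have /(has_nthP false)[r] : has id (e (chunk b k)).
    by rewrite has_count -double_gt0 e2 size_tuple.
  rewrite size_tuple => rL Gr; exists (k * L + r)%N; last by rewrite GE.
  by rewrite leq_addr mulSnr ltn_add2l.
- move=> b c k agree i ik.
  have q0 : (0 < q)%N by case: (q) ik; rewrite ?muln0.
  (* Bit [i] sits in chunk [i %/ q], which is below [k]; its Dyck words coincide and [e] is
     injective. *)
  have bc : chunk b (i %/ q)%N = chunk c (i %/ q)%N.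
    apply: inje; apply: val_inj; apply: (@eq_from_nth _ false).
      by rewrite !size_tuple.
    move=> r; rewrite size_tuple => rL; rewrite -!GE//; apply: agree.
    have : (i %/ q < k)%N by rewrite ltn_divLR.
    by nia.
  move/(congr1 (fun t => tnth t (Ordinal (ltn_pmod i q0)))) : bc.
  by rewrite !tnth_mktuple /= -divn_eq.
Qed.

(** With [p = m.*2] the length is the square of [2 ^ m], hence at least [m.+1 ^ 2], against a loss
    of at most [4 * m + 2] bits per chunk. *)
Lemma dyck_rate (R : realType) (m : nat) :
  1 - 4 / m.+1%:R <=
  (2 ^ m.*2 - m.*2.*2 - 2)%:R / (2 ^ m.*2)%:R :> R.
Proof.
have m2 : (m < 2 ^ m)%N by exact: ltn_expl.
have L2 : (2 ^ m.*2 = 2 ^ m * 2 ^ m)%N by rewrite -addnn expnD.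
set q := (_ - _ - _)%N; set L := (2 ^ m.*2)%N.
have L0 : 0 < L%:R :> R by rewrite ltr0n expn_gt0.
have m0 : 0 < m.+1%:R :> R by [].
have qL : (L <= q + (m.*2.*2 + 2))%N by rewrite /q; lia.
have mL : ((m.*2.*2 + 2) * m.+1 <= 4 * L)%N by rewrite /L L2; nia.
have Lq : (L * m.+1 <= q * m.+1 + 4 * L)%N by nia.
rewrite ler_pdivlMr// mulrBl mul1r mulrAC lerBlDr -lerBlDl ler_pdivlMr//.
by rewrite mulrBl lerBlDl -!natrM -natrD ler_nat.
Qed.

Lemma hausdorff_dim_LambdaHL (R : realType) :
  hausdorff_dim (expansion_val R @` LambdaHL R) = 1%E.
Proof.
apply/eqP; rewrite eq_le; apply/andP; split.
  by apply: hausdorff_dim_le1; exact: expansion_val_image_sub.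
apply/lee_subgt0Pr => e e0.
(* Large enough for [4 / m.+1 <= e]; being a successor, it also makes [m.*2] positive. *)
pose m := (Num.truncn (4 / e)).+1.
have me : 4 / m.+1%:R <= e.
  rewrite ler_pdivrMr// mulrC -ler_pdivrMr// ltW//.
  by apply: (lt_trans (truncnS_gt _)); rewrite ltr_nat.
apply: le_trans (@hausdorff_dim_LambdaHL_ge R m.*2 _); last by [].
rewrite -EFinB lee_fin; apply: le_trans (dyck_rate R m).
by rewrite lerD2l lerN2.
Qed.

Local Open Scope ereal_scope.

Theorem theorem6p1 (R : realType) :
  hausdorff_dim (expansion_val R @` LambdaHL R) = 1 /\
  hausdorff_dim (expansion_val R @` deficient_digit_set) = 1.
Proof.
split; first exact: hausdorff_dim_LambdaHL.
apply/eqP; rewrite eq_le hausdorff_dim_le1 /=; last first.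
  exact: expansion_val_image_sub.
rewrite -(hausdorff_dim_LambdaHL R); apply: hausdorff_dim_sub.
by move=> _ [b [bd _] <-]; exists b.
Qed.
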